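(* Let $p$ be an odd prime and $m$ a positive integer, and let $\alpha$ be a fixed non-square element of $\mathbb{F}_{p^m}$. For an integer $k$ with $m/\gcd(m,k)$ odd and a field automorphism $\sigma$ of $\mathbb{F}_{p^m}$, let $\mathbb{P}_{k,\sigma}=(\mathbb{F}_{p^m}^2,+,*_{k,\sigma})$ be the presemifield with $$(a,b)*_{k,\sigma}(c,d)=\big(a\circ_k c+\alpha\,\sigma(b\circ_k d),\ ad+bc\big),\qquad x\circ_k y=x^{p^k}y+y^{p^k}x.$$ Let $0<k,s\le\lfloor m/2\rfloor$ with $m/\gcd(m,k)$ and $m/\gcd(m,s)$ odd, and $0\le r,t\le\lfloor m/2\rfloor$, and let $\sigma(x)=x^{p^r}$, $\tau(x)=x^{p^t}$. If $(k,\sigma)\neq(s,\tau)$, then $\mathbb{P}_{k,\sigma}$ and $\mathbb{P}_{s,\tau}$ are not strongly isotopic.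
   Context: Two presemifields $(\mathbb{F}_p^n,+,* )$ and $(\mathbb{F}_p^n,+,\star)$ are isotopic if there are $\mathbb{F}_p$-linear bijections $M,N,L$ with $M(x)\star N(y)=L(x*y)$ for all $x,y$; they are strongly isotopic if such an isotopism exists with $M=N$. For commutative presemifields of odd characteristic, strong isotopism is equivalent to linear equivalence of the planar functions $x\mapsto x*x$. *)

(* Defs.v *)
From HB Require Import structures.
From mathcomp Require Import all_boot all_order all_algebra all_field.
Set Implicit Arguments. Unset Strict Implicit. Unset Printing Implicit Defensive.
Import GRing.Theory.
Local Open Scope ring_scope.

Definition circ (F : finFieldType) (p k : nat) (x y : F) : F :=
  x ^+ (p ^ k) * y + y ^+ (p ^ k) * x.

Definition pmul (F : finFieldType) (p k : nat) (sigma : F -> F) (alpha : F)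
  (u v : F * F) : F * F :=
  (circ p k u.1 v.1 + alpha * sigma (circ p k u.2 v.2), u.1 * v.2 + u.2 * v.1).

(* F_p-linear map on a Z-module of characteristic p = additive map *)
Definition additive_map (T : zmodType) (f : T -> T) : Prop :=
  forall x y, f (x + y) = f x + f y.

Definition strongly_isotopic (T : zmodType) (mul1 mul2 : T -> T -> T) : Prop :=
  exists M L : T -> T,
    [/\ additive_map M, bijective M, additive_map L, bijective L &
        forall x y, mul2 (M x) (M y) = L (mul1 x y)].

(* Main.v *)
(** Additive maps of F_{p^m} are uniquely the linearized polynomials
    sum_i a_i x^(p^i), with i in Z/m, and likewise biadditive maps have unique
    coefficients on the monomials x^(p^i) y^(p^j).  Write a strong isotopism as
    M(x, y) = (A x + B y, C x + D y) and L(u, v) = (L1 u + L2 v, L3 u + L4 v), and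
    compare coefficients.  The second component shows that A and D are monomials
    of the same degree p^i, that B and C are monomials of the same degree p^j, and
    that either one of these two pairs vanishes or i - j = k or j - i = k.  The
    first component then says that L1(x o_k y) and L1(alpha sigma(x o_k y)) are
    sums of at most two terms of the form c (x o_s y)^(p^v), whose positions v
    force s = k and r = t.  The parity condition on m / gcd(m, k) only enters
    through 2k <> 0 in Z/m. *)
Require Import Defs.
From mathcomp Require Import all_boot all_order all_algebra all_field.
From mathcomp Require Import zify.
Import GRing.Theory.
Local Open Scope ring_scope.
Set Implicit Arguments. Unset Strict Implicit. Unset Printing Implicit Defensive.

(** * Frobenius powers and linearized polynomials *)

Section LinearizedPolynomials.
Variables (F : finFieldType) (p n : nat).
Hypotheses (p_prime : prime p) (cardF : #|F| = (p ^ n.+1)%N).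

Let pcharF : p \in [pchar F] := card_finPcharP cardF p_prime.

(** Addition in ['I_n.+1] is modulo [n.+1], so indices form the cyclic group generated by the
    Frobenius map. *)
Definition frob (i : 'I_n.+1) (x : F) : F := x ^+ (p ^ i).

Lemma frobD i : {morph frob i : x y / x + y}.
Proof.
move=> x y; apply: exprDn_pchar.
by rewrite pnatX (eq_pnat _ (pcharf_eq pcharF)) pnat_id.
Qed.

Lemma frobM i : {morph frob i : x y / x * y}.
Proof. by move=> x y; apply: exprMn. Qed.

Lemma frob_id0 i : frob i 0 = 0.
Proof. by rewrite /frob expr0n expn_eq0 eqn0Ngt prime_gt0. Qed.

Lemma frob_eq0 i x : (frob i x == 0) = (x == 0).
Proof. by rewrite /frob expf_eq0 expn_gt0 prime_gt0. Qed.

Lemma frob0 x : frob 0 x = x.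
Proof. exact: expr1. Qed.

Lemma frob_sum i (I : finType) (g : I -> F) :
  frob i (\sum_j g j) = \sum_j frob i (g j).
Proof. exact: (big_morph (frob i) (@frobD i) (@frob_id0 i)). Qed.

Lemma expf_modn (x : F) e : x ^+ (p ^ e) = x ^+ (p ^ (e %% n.+1)%N).
Proof.
rewrite {1}(divn_eq e n.+1); elim: (e %/ n.+1)%N => [|q IH].
  by rewrite mul0n add0n.
by rewrite mulSn -addnA expnD exprM -cardF expf_card.
Qed.

Lemma frob_comp i j x : frob i (frob j x) = frob (i + j) x.
Proof. by rewrite /frob -exprM -expnD addnC [RHS]/= expf_modn. Qed.

Definition lin (a : 'I_n.+1 -> F) (x : F) : F := \sum_i a i * frob i x.

Lemma linD a : additive_map (lin a).
Proof.
by move=> x y; rewrite /lin -big_split; apply: eq_bigr => i _; rewrite frobD mulrDr.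
Qed.

(** The polynomial with coefficients [a j] at X^(p^j) has degree below |F| but would have every
    element of F as a root. *)
Lemma lin_eq0 a : (forall x, lin a x = 0) -> forall i, a i = 0.
Proof.
move=> a0 i.
pose P : {poly F} := \sum_(j < n.+1) a j *: 'X^(p ^ j).
have Pi : P`_(p ^ i) = a i.
  rewrite coef_sum (bigD1 i) //= coefZ coefXn eqxx mulr1 big1 ?addr0 // => j ji.
  rewrite coefZ coefXn eqn_exp2l ?prime_gt1 //.
  by rewrite eq_sym val_eqE (negbTE ji) mulr0.
suff P0 : P = 0 by rewrite -Pi P0 coef0.
apply/eqP; apply: contraT => Pn0.
have sizeP : (size P <= p ^ n.+1)%N.
  apply: leq_trans (size_sum _ _ _) _; apply/bigmax_leqP => j _.
  apply: leq_trans (size_scale_leq _ _) _.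
  by rewrite size_polyXn ltn_exp2l ?prime_gt1.
have := max_poly_roots Pn0 (rs := enum F) _ (enum_uniq _).
rewrite -cardE cardF ltnNge sizeP; apply.
apply/allP => x _; rewrite rootE horner_sum -[X in _ == X](a0 x); apply/eqP.
by apply: eq_bigr => j _; rewrite hornerZ hornerXn.
Qed.

(** A basis over the prime field; natural coefficients let any additive map pass through the sum. *)
Lemma exists_generators :
  exists e : 'I_n.+1 -> F, forall x, exists c : 'I_n.+1 -> nat,
    x = \sum_j e j *+ c j.
Proof.
pose vT := pPrimeCharType pcharF.
have dimF : \dim {: vT} = n.+1.
  apply: (@expnI p (prime_gt1 p_prime)); rewrite -cardF.
  by rewrite pprimeChar_dimf -card_pprimeChar.
suff [e eP] : exists e : 'I_(\dim {: vT}) -> F, forall x,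
    exists c : 'I_(\dim {: vT}) -> nat, x = \sum_j e j *+ c j.
  by case: _ / dimF e eP => e eP; exists e.
exists (fun j => (vbasis {: vT})`_j) => x.
exists (fun j => coord (vbasis {: vT}) j x : nat).
rewrite {1}(coord_vbasis (memvf (x : vT))); apply: eq_bigr => j _.
by rewrite -[RHS]mulr_natl.
Qed.

(* The Moore matrix of a basis over the prime field is invertible, so an
   additive map can be interpolated on that basis. *)
Lemma additive_lin f : additive_map f -> exists a, forall x, f x = lin a x.
Proof.
move=> fD; have [e eP] := exists_generators.
have f0 : f 0 = 0 by apply: (addrI (f 0)); rewrite -fD !addr0.
have lincomb g : additive_map g -> g 0 = 0 -> forall c : 'I_n.+1 -> nat,
    g (\sum_j e j *+ c j) = \sum_j g (e j) *+ c j.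
  move=> gD g0 c; rewrite (big_morph g gD g0); apply: eq_bigr => j _.
  by elim: (c j) => [|q IH]; rewrite ?mulr0n // !mulrS gD IH.
have lin0 a : lin a 0 = 0 by rewrite /lin big1 // => i _; rewrite frob_id0 mulr0.
pose W : 'M[F]_n.+1 := \matrix_(i, j) frob i (e j).
have mulW (v : 'rV_n.+1) j : (v *m W) 0 j = lin (fun i => v 0 i) (e j).
  by rewrite !mxE; apply: eq_bigr => i _; rewrite mxE.
(* A row vector killed by [W] is a linearized polynomial vanishing on the generators, hence
   everywhere. *)
have Wunit : W \in unitmx.
  rewrite -row_free_unit; apply: inj_row_free => v vW.
  apply/rowP => i; rewrite mxE; move: i; apply: lin_eq0 => x.
  have [c ->] := eP x; rewrite (lincomb _ (@linD _) (lin0 _)) big1 // => j _.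
  by rewrite -mulW vW mxE mul0rn.
pose v := (\row_j f (e j)) *m invmx W.
exists (fun i => v 0 i) => x; have [c ->] := eP x; rewrite (lincomb _ fD f0).
rewrite (lincomb _ (@linD _) (lin0 _)).
by apply: eq_bigr => j _; rewrite -mulW mulmxKV // mxE.
Qed.

Lemma frob_lin s a x : frob s (lin a x) = lin (fun i => frob s (a (i - s))) x.
Proof.
rewrite frob_sum [RHS](reindex_inj (addIr s)); apply: eq_bigr => i _.
by rewrite addrK frobM frob_comp addrC.
Qed.

(** * Biadditive maps and their coefficient matrices *)

Definition bilin (h : 'I_n.+1 -> 'I_n.+1 -> F) (x y : F) : F :=
  \sum_i \sum_j h i j * (frob i x * frob j y).

Lemma bilinE h x y : bilin h x y = lin (fun i => lin (h i) y) x.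
Proof.
apply: eq_bigr => i _; rewrite mulr_suml; apply: eq_bigr => j _.
by rewrite -mulrA [frob i x * _]mulrC.
Qed.

(** Uniqueness of linearized polynomials, applied in each variable in turn. *)
Lemma bilin_inj g h : (forall x y, bilin g x y = bilin h x y) -> g =2 h.
Proof.
move=> gh i j; apply/eqP; rewrite -subr_eq0; apply/eqP.
apply: (@lin_eq0 (fun j => g i j - h i j)) => y.
apply: (@lin_eq0 (fun i => lin (fun j => g i j - h i j) y)) => x.
transitivity (bilin g x y - bilin h x y); last by rewrite gh subrr.
rewrite !bilinE /lin -sumrB; apply: eq_bigr => i' _; rewrite -mulrBl.
by congr (_ * _); rewrite -sumrB; apply: eq_bigr => j' _; rewrite mulrBl.
Qed.

Lemma bilinD g h x y :
  bilin g x y + bilin h x y = bilin (fun i j => g i j + h i j) x y.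
Proof.
rewrite -big_split; apply: eq_bigr => i _; rewrite -big_split.
by apply: eq_bigr => j _; rewrite mulrDl.
Qed.

Lemma bilinZ c h x y : c * bilin h x y = bilin (fun i j => c * h i j) x y.
Proof.
rewrite mulr_sumr; apply: eq_bigr => i _; rewrite mulr_sumr.
by apply: eq_bigr => j _; rewrite mulrA.
Qed.

Lemma lin_mul a c x y : lin a x * lin c y = bilin (fun i j => a i * c j) x y.
Proof.
rewrite mulr_suml; apply: eq_bigr => i _; rewrite mulr_sumr.
by apply: eq_bigr => j _; rewrite mulrACA.
Qed.

Lemma lin_mulr l k x y :
  lin l (frob k x * y) = bilin (fun i j => l j *+ (i == j + k)) x y.
Proof.
rewrite /bilin exchange_big; apply: eq_bigr => j _.
rewrite (bigD1 (j + k)) //= eqxx mulr1n big1 ?addr0 => [|i /negbTE->].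
  by rewrite frobM frob_comp.
by rewrite mulr0n mul0r.
Qed.

Lemma bilinC h x y : bilin h x y = bilin (fun i j => h j i) y x.
Proof.
rewrite /bilin exchange_big; apply: eq_bigr => i _; apply: eq_bigr => j _.
by rewrite [frob _ x * _]mulrC.
Qed.

(** * Coefficients of the products o_k *)

Lemma frob_circ t s x y :
  frob t (circ p s x y) = circ p s (frob t x) (frob t y).
Proof. by rewrite /circ frobD !frobM /frob !(exprAC _ (p ^ s)). Qed.

(* [circ_coef k l] and [lin_circ_coef s a] are the coefficient matrices of
   L(x o_k y) and A(x) o_s A(y), and [twist r alpha l] are the coefficients of
   z |-> L(alpha z^(p^r)). *)
Definition circ_coef (k : 'I_n.+1) (l : 'I_n.+1 -> F) i j : F :=
  l j *+ (i == j + k) + l i *+ (j == i + k).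

Lemma lin_circ l (k : 'I_n.+1) x y :
  lin l (circ p k x y) = bilin (circ_coef k l) x y.
Proof. by rewrite linD !lin_mulr [X in _ + X]bilinC bilinD. Qed.

Definition lin_circ_coef (s : 'I_n.+1) (a : 'I_n.+1 -> F) i j : F :=
  frob s (a (i - s)) * a j + a i * frob s (a (j - s)).

Lemma circ_lin (s : 'I_n.+1) a x y :
  circ p s (lin a x) (lin a y) = bilin (lin_circ_coef s a) x y.
Proof.
rewrite /circ -[_ ^+ _]/(frob s _) -[lin a y ^+ _]/(frob s _).
by rewrite [X in _ + X]mulrC !frob_lin !lin_mul bilinD.
Qed.

Definition twist (r : 'I_n.+1) (alpha : F) (l : 'I_n.+1 -> F) v : F :=
  l (v - r) * frob (v - r) alpha.

Lemma lin_twist r alpha l z : lin l (alpha * frob r z) = lin (twist r alpha l) z.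
Proof.
rewrite [RHS](reindex_inj (addIr r)); apply: eq_bigr => i _.
by rewrite /twist addrK frobM frob_comp mulrA.
Qed.

(** * Supports of the coefficient matrices *)

Definition monomial (a : 'I_n.+1 -> F) i := forall j, j != i -> a j = 0.

Lemma twist_shift r alpha l v : twist r alpha l (v + r) = l v * frob v alpha.
Proof. by rewrite /twist addrK. Qed.

Lemma twist_neq0 r alpha l v :
  alpha != 0 -> (twist r alpha l v != 0) = (l (v - r) != 0).
Proof. by move=> al0; rewrite mulf_eq0 frob_eq0 (negbTE al0) orbF. Qed.

(** The symmetric term could contribute only if v = v + k + k. *)
Lemma circ_coef_shift k l v : k + k != 0 -> circ_coef k l (v + k) v = l v.
Proof.
move=> kk; rewrite /circ_coef eqxx mulr1n.
by rewrite -addrA -[X in X == _]addr0 (inj_eq (addrI v)) eq_sym (negbTE kk) addr0.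
Qed.

Lemma circ_coef_neq0 k l i j :
  circ_coef k l i j != 0 ->
  (i = j + k \/ j = i + k) /\ (exists v, l v != 0).
Proof.
rewrite /circ_coef; case: (i =P j + k) => [ijk|_].
  move=> lij; split; first by left.
  have [lj0|lj0] := eqVneq (l j) 0; last by exists j.
  exists i; apply: contraNneq lij => li0.
  by rewrite li0 lj0 !mul0rn addr0.
case: (j =P i + k) => [jik|_]; last by rewrite addr0 eqxx.
by rewrite add0r => li0; split; [right | exists i].
Qed.

(** The support consists of positions with index difference k or -k, and s = -k is excluded. *)
Lemma circ_coef_eq k s l v :
  s + k != 0 -> circ_coef k l (v + s) v != 0 -> s = k.
Proof.
move=> sk /circ_coef_neq0[[/addrI//|vE] _].
case/eqP: sk; apply: (addrI v); by rewrite addr0 addrA -vE.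
Qed.

(** The symmetric term would need both v + s and v - s to equal i, hence s + s = 0. *)
Lemma lin_circ_coef_monomial s a i v : s + s != 0 -> monomial a i ->
  lin_circ_coef s a (v + s) v = (frob s (a i) * a i) *+ (v == i).
Proof.
move=> ss ai; rewrite /lin_circ_coef addrK.
have -> : a (v + s) * frob s (a (v - s)) = 0.
  have [/eqP|vs] := eqVneq (v + s) i; last by rewrite ai ?mul0r.
  move=> /eqP vsi; rewrite [a (v - s)]ai ?frob_id0 ?mulr0 // -vsi.
  by rewrite (inj_eq (addrI v)) eq_sym -addr_eq0.
by case: eqVneq => [->|vi]; rewrite addr0 // ai ?mulr0.
Qed.

Lemma monomial_shift t a i :
  monomial a i -> monomial (fun v => frob t (a (v - t))) (i + t).
Proof.
move=> ai j ji; rewrite ai ?frob_id0 //; apply: contraNneq ji => <-.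
by rewrite subrK.
Qed.

(** The equations are those of the second component, with [l] the coefficients of L3. Off the
    diagonal, row and column [i] of the third one retain a single product, which pins [a] and [d] to
    [i]; a non-zero [c j] then pins [b] and [c] to [j]. *)
Lemma monomial_pair k r alpha a b c d l i :
  k + k != 0 -> alpha != 0 ->
  (forall u v, a u * c v + c u * a v = circ_coef k l u v) ->
  (forall u v, b u * d v + d u * b v = circ_coef k (twist r alpha l) u v) ->
  (forall u v, u != v -> a u * d v + c u * b v = 0) ->
  a i != 0 -> b i = 0 -> c i = 0 -> d i != 0 ->
  [/\ monomial a i, monomial d i &
     (forall v, b v = 0) /\ (forall v, c v = 0) \/
     exists j, [/\ i = j + k \/ j = i + k, b j != 0, c j != 0,
                    monomial b j & monomial c j]].
Proof.
move=> kk al0 E1 E2 E3 ai bi ci di.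
have ma : monomial a i.
  move=> j ji; have := E3 j i ji; rewrite bi mulr0 addr0 => /eqP.
  by rewrite mulf_eq0 (negbTE di) orbF => /eqP.
have md : monomial d i.
  move=> j ji; have := E3 i j; rewrite eq_sym ci mul0r addr0 => /(_ ji)/eqP.
  by rewrite mulf_eq0 (negbTE ai) => /eqP.
split=> //.
have [/forallP c0|/forallPn[j cj]] := boolP [forall v, c v == 0].
  left; split=> [v|v]; last exact/eqP.
  (* With C = 0 the first equation gives L3 = 0, so the second one, in column [i], kills [b]. *)
  have l0 u : l u = 0.
    by rewrite -(circ_coef_shift l u kk) -E1 !(eqP (c0 _)) mulr0 mul0r addr0.
  have := E2 v i; rewrite bi mulr0 addr0 /circ_coef /twist !l0 !mul0r !mul0rn addr0.
  by move/eqP; rewrite mulf_eq0 (negbTE di) orbF => /eqP.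
right; exists j.
have ji : j != i by apply: contraNneq cj => ->; rewrite ci.
(* The entry (i, j) of the first equation is [a i * c j], which is non-zero. That L3 is non-zero
   will exclude [b j = 0]. *)
have [ij [v lv]] : (i = j + k \/ j = i + k) /\ (exists v, l v != 0).
  by apply: circ_coef_neq0; rewrite -E1 ci mul0r addr0 mulf_neq0.
have cb u w : u != w -> c u * b w = 0.
  move=> uw; have := E3 u w uw; have [wi|/md->] := eqVneq w i.
    by rewrite wi bi !mulr0.
  by rewrite mulr0 add0r.
have mb : monomial b j.
  move=> w wj; have jw : j != w by rewrite eq_sym.
  have /eqP := cb j w jw.
  by rewrite mulf_eq0 (negbTE cj) => /eqP.
have bj : b j != 0.
  apply: contraNneq (_ : twist r alpha l (v + r) != 0) => [bj|]; last first.
    by rewrite twist_neq0 // addrK.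
  have b0 w : b w = 0 by have [->|/mb] := eqVneq w j.
  by rewrite -(circ_coef_shift _ (v + r) kk) -E2 !b0 mul0r mulr0 addr0.
split=> // w wj; have /eqP := cb w j wj.
by rewrite mulf_eq0 (negbTE bj) orbF => /eqP.
Qed.

(* Otherwise all vectors (a_u, c_u), which lie on the coordinate axes, would be
   orthogonal to all (d_v, b_v), leaving a zero row or column in ((a, b), (c, d)). *)
Lemma exists_diagonal (a b c d : 'I_n.+1 -> F) :
  (exists i, a i != 0 \/ b i != 0) -> (exists i, c i != 0 \/ d i != 0) ->
  (exists i, a i != 0 \/ c i != 0) -> (exists i, b i != 0 \/ d i != 0) ->
  (forall u, a u * c u = 0) ->
  (forall u v, u != v -> a u * d v + c u * b v = 0) ->
  exists i, a i * d i + c i * b i != 0.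
Proof.
move=> abn0 cdn0 acn0 bdn0 ac0 E3; apply/existsP; rewrite -negb_forall.
apply/negP => /forallP diag0.
have E u v : a u * d v + c u * b v = 0.
  by have [->|/E3] := eqVneq u v; first exact/eqP.
have [/forallP a0|/forallPn[u au]] := boolP [forall v, a v == 0].
  have [i [|ci]] := acn0; first by rewrite a0.
  have [j [|bj]] := abn0; first by rewrite a0.
  have /eqP := E i j; rewrite (eqP (a0 _)) mul0r add0r mulf_eq0.
  by rewrite (negbTE ci) (negbTE bj).
have cu : c u = 0 by apply/eqP; have /eqP := ac0 u; rewrite mulf_eq0 (negbTE au).
have d0 v : d v = 0.
  by apply/eqP; have /eqP := E u v; rewrite cu mul0r addr0 mulf_eq0 (negbTE au).
have [i [ci|]] := cdn0; last by rewrite d0 eqxx.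
have [j [bj|]] := bdn0; last by rewrite d0 eqxx.
have /eqP := E i j; rewrite d0 mulr0 add0r mulf_eq0.
by rewrite (negbTE ci) (negbTE bj).
Qed.

(* The two equations are the coefficients at (v + s, v) of the identities
   A o_s A + alpha tau(C o_s C) = L1(x o_k y) and
   B o_s B + alpha tau(D o_s D) = L1(alpha sigma(x o_k y)). *)
Lemma circ_coef_rigidity (k s r t : 'I_n.+1) (P Q P' Q' alpha : F) l (i j : 'I_n.+1) :
  k + k != 0 -> s + k != 0 ->
  (r + t = 0 -> r = t) -> alpha != 0 ->
  (forall v, P *+ (v == i) + Q *+ (v == j + t) = circ_coef k l (v + s) v) ->
  (forall v, P' *+ (v == j) + Q' *+ (v == i + t)
     = circ_coef k (twist r alpha l) (v + s) v) ->
  [\/ [/\ P != 0, Q' != 0, Q = 0 & P' = 0],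
      [/\ Q != 0, P' != 0, P = 0 & Q' = 0] |
      [/\ P != 0, Q' != 0, Q != 0, P' != 0 & i = j + k \/ j = i + k]] ->
  s = k /\ r = t.
Proof.
move=> kk sk rt al0 E4 E5 H.
(* Once s = k, the equations place the support of [l] inside {i, j + t} and inside {j - r, i + t -
   r}; matching the two sets yields r = t. *)
have suppl v : s = k -> l v = P *+ (v == i) + Q *+ (v == j + t).
  by move=> e; rewrite E4 e circ_coef_shift.
have suppt v : s = k -> l v * frob v alpha = P' *+ (v + r == j) + Q' *+ (v + r == i + t).
  by move=> e; rewrite E5 e circ_coef_shift // twist_shift.
have frob0 v : frob v alpha != 0 by rewrite frob_eq0.
case: H => [[P0 Q'0 Q0 P'0]|[Q0 P'0 P0 Q'0]|[P0 Q'0 Q0 P'0 ij]].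
- have e : s = k.
    by apply: (circ_coef_eq (l := l) (v := i)) => //; rewrite -E4 eqxx Q0 mul0rn addr0.
  split=> //; have /eqP := suppt i e.
  rewrite suppl // eqxx Q0 P'0 !mul0rn addr0 add0r mulr1n.
  case: (i + r =P i + t) => [ir _|_]; first exact: (addrI i).
  by rewrite mulr0n mulf_eq0 (negbTE P0) (negbTE (frob0 _)).
- have e : s = k.
    by apply: (circ_coef_eq (l := l) (v := j + t)) => //; rewrite -E4 eqxx P0 mul0rn add0r.
  split=> //; have /eqP := suppt (j + t) e.
  rewrite suppl // eqxx P0 Q'0 !mul0rn addr0 add0r mulr1n.
  case: (j + t + r =P j) => [/eqP|_]; last by rewrite mulr0n mulf_eq0 (negbTE Q0) (negbTE (frob0 _)).
  by rewrite -addrA -[X in _ == X]addr0 (inj_eq (addrI j)) addrC => /eqP tr _; apply: rt.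
(* Both equalities give r + r = 0, and k = r because i and j differ by k. *)
have no_swap : i + r = j -> j + r = i -> False.
  move=> ir jr; case/eqP: kk; suff -> : k = r by apply: (addrI i); rewrite addrA ir jr addr0.
  by case: ij => h; [apply: (addrI j); rewrite -h jr | apply: (addrI i); rewrite -h ir].
have swap_rt : (r = t \/ i + r = j) -> (r = t \/ j + r = i) -> r = t.
  by case=> // ir [//|jr]; case: (no_swap ir jr).
(* If i = j + t, the terms in [P] and [Q] share a position and may cancel; s = k is then read off
   the second equation. *)
have [iE|ijt] := eqVneq i (j + t); last first.
  have e : s = k.
    by apply: (circ_coef_eq (l := l) (v := i)) => //; rewrite -E4 eqxx (negbTE ijt) addr0.
  split=> //; apply: swap_rt.
    have /eqP := suppt i e; rewrite suppl // eqxx (negbTE ijt) addr0 mulr1n.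
    have [->|_] := eqVneq (i + r) j; first by right.
    case: (i + r =P i + t) => [ir _|_]; first by left; apply: (addrI i).
    by rewrite addr0 mulf_eq0 (negbTE P0) (negbTE (frob0 _)).
  have /eqP := suppt (j + t) e; rewrite suppl // eqxx [j + t == i]eq_sym (negbTE ijt) add0r mulr1n.
  have [|_] := eqVneq (j + t + r) j.
    rewrite -addrA -[X in _ = X]addr0 => /(addrI j) tr _.
    by left; apply: rt; rewrite addrC.
  case: (j + t + r =P i + t) => [jr _|_]; last by rewrite addr0 mulf_eq0 (negbTE Q0) (negbTE (frob0 _)).
  by right; apply: (addrI t); rewrite [LHS]addrC -addrA [r + t]addrC addrA jr addrC.
(* A collision in both equations would give t + t = 0 and k = t. *)
have [jE|jit] := eqVneq j (i + t).
  have tt : t + t = 0 by apply: (addrI j); rewrite addrA -iE -jE addr0.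
  case/eqP: kk; suff -> : k = t by [].
  by case: ij => h; [apply: (addrI j); rewrite -h -iE | apply: (addrI i); rewrite -h -jE].
have e : s = k.
  by apply: (circ_coef_eq (l := twist r alpha l) (v := j)) => //; rewrite -E5 eqxx (negbTE jit) addr0.
split=> //; apply: swap_rt; last first.
  have := suppt (i + t - r) e; rewrite subrK eqxx [_ == j]eq_sym (negbTE jit) add0r suppl //.
  have [iE0|_] := eqVneq (i + t - r) i.
    by left; apply/(addrI i); rewrite -[in LHS]iE0 subrK.
  have [jE2|_] := eqVneq (i + t - r) (j + t).
    by move=> _; right; apply: (addrI t); rewrite [RHS]addrC -[i + t](subrK r) jE2 addrC addrAC.
  by move/eqP; rewrite addr0 mul0r eq_sym (negbTE Q'0).
have := suppt (j - r) e; rewrite subrK eqxx (negbTE jit) addr0 suppl //.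
have [jr _|_] := eqVneq (j - r) i; first by right; rewrite -jr subrK.
have [jE _|_] := eqVneq (j - r) (j + t); last first.
  by move/eqP; rewrite addr0 mul0r eq_sym (negbTE P'0).
by left; apply: rt; move/(addrI j): jE => <-; rewrite subrr.
Qed.

(** * From a strong isotopism to equal parameters *)

Lemma lin_exists_neq0 a b x y :
  lin a x != 0 \/ lin b y != 0 -> exists i, a i != 0 \/ b i != 0.
Proof.
move=> ab; have [/existsP[i /orP abi]|] := boolP [exists i, (a i != 0) || (b i != 0)].
  by exists i.
rewrite negb_exists => /forallP ab0.
have a0 i : a i = 0 by have := ab0 i; rewrite negb_or !negbK => /andP[/eqP].
have b0 i : b i = 0 by have := ab0 i; rewrite negb_or !negbK => /andP[_ /eqP].
by case: ab => /eqP; case; apply: big1 => i _; rewrite ?a0 ?b0 mul0r.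
Qed.

(** The bounds by m/2 and the parity conditions appear here as conditions in Z/m. *)
Lemma strong_isotopy_parameters (k s r t : 'I_n.+1) alpha :
  odd p -> alpha != 0 -> k + k != 0 -> s + s != 0 -> s + k != 0 ->
  (r + t = 0 -> r = t) ->
  strongly_isotopic (pmul p k (frob r) alpha) (pmul p s (frob t) alpha) ->
  s = k /\ r = t.
Proof.
move=> p_odd al0 kk ss sk rt [M [L [MD Mbij LD _ ML]]].
have additive_part (f : F * F -> F * F) (g : F -> F * F) (h : F * F -> F) :
    additive_map f -> {morph g : x y / x + y} -> {morph h : x y / x + y} ->
    exists a, forall x, h (f (g x)) = lin a x.
  by move=> fD gD hD; apply: additive_lin => x y; rewrite gD fD hD.
have inlD : {morph (fun x : F => (x, 0 : F)) : x y / x + y}.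
  by move=> x y; rewrite /= -[RHS]/(_, _) /= addr0.
have inrD : {morph (fun x : F => (0 : F, x)) : x y / x + y}.
  by move=> x y; rewrite /= -[RHS]/(_, _) /= addr0.
have fstD : {morph (fun u : F * F => u.1) : x y / x + y} by [].
have sndD : {morph (fun u : F * F => u.2) : x y / x + y} by [].
have [a aP] := additive_part _ _ _ MD inlD fstD.
have [c cP] := additive_part _ _ _ MD inlD sndD.
have [b bP] := additive_part _ _ _ MD inrD fstD.
have [d dP] := additive_part _ _ _ MD inrD sndD.
have [l1 l1P] := additive_part _ _ _ LD inlD fstD.
have [l3 l3P] := additive_part _ _ _ LD inlD sndD.
have [l4 l4P] := additive_part _ _ _ LD inrD sndD.
have pow0 (q : 'I_n.+1) : (0 : F) ^+ (p ^ q) = 0 := frob_id0 q.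
have circ0r (q : 'I_n.+1) (x : F) : circ p q x 0 = 0.
  by rewrite /circ pow0 mulr0 mul0r addr0.
have circ0l (q : 'I_n.+1) (x : F) : circ p q 0 x = 0.
  by rewrite /circ pow0 mulr0 mul0r addr0.
(* Products of vectors on the coordinate axes isolate the blocks of M and L. *)
have mul_ll (x y : F) : pmul p k (frob r) alpha (x, 0) (y, 0) = (circ p k x y, 0).
  by rewrite /pmul /= circ0r frob_id0 !mulr0 mul0r !addr0.
have mul_rr (x y : F) : pmul p k (frob r) alpha (0, x) (0, y) =
    (alpha * frob r (circ p k x y), 0).
  by rewrite /pmul /= circ0r !mul0r mulr0 addr0 add0r.
have mul_lr (x y : F) : pmul p k (frob r) alpha (x, 0) (0, y) = (0, x * y).
  by rewrite /pmul /= circ0r circ0l frob_id0 mulr0 mul0r !addr0.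
(* [tw g] holds the coefficients of tau composed with [lin g]. Below, [E1] to [E3] compare second
   components, [E4] and [E5] first components. *)
pose tw (g : 'I_n.+1 -> F) v := frob t (g (v - t)).
have E1 : (fun u v => a u * c v + c u * a v) =2 circ_coef k l3.
  apply: bilin_inj => x y; rewrite -bilinD -!lin_mul -lin_circ.
  by rewrite -!aP -!cP -l3P -mul_ll -ML.
have E2 : (fun u v => b u * d v + d u * b v) =2 circ_coef k (twist r alpha l3).
  apply: bilin_inj => x y; rewrite -bilinD -!lin_mul -lin_circ -lin_twist.
  by rewrite -!bP -!dP -l3P -mul_rr -ML.
have E3 : (fun u v => a u * d v + c u * b v) =2 (fun u v => l4 v *+ (u == v + 0)).
  apply: bilin_inj => x y; rewrite -bilinD -!lin_mul -lin_mulr frob0.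
  by rewrite -aP -bP -cP -dP -l4P -mul_lr -ML.
have E4 : (fun u v => lin_circ_coef s a u v + alpha * lin_circ_coef s (tw c) u v)
    =2 circ_coef k l1.
  apply: bilin_inj => x y; rewrite -bilinD -bilinZ -!circ_lin -!frob_lin -frob_circ.
  by rewrite -lin_circ -!aP -!cP -l1P -mul_ll -ML.
have E5 : (fun u v => lin_circ_coef s b u v + alpha * lin_circ_coef s (tw d) u v)
    =2 circ_coef k (twist r alpha l1).
  apply: bilin_inj => x y; rewrite -bilinD -bilinZ -!circ_lin -!frob_lin -frob_circ.
  by rewrite -lin_circ -lin_twist -!bP -!dP -l1P -mul_rr -ML.
have M0 : M (0, 0) = 0 by apply: (addrI (M (0, 0))); rewrite -MD !addr0.
have Msum x y : M (x, y) = M (x, 0) + M (0, y).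
  by rewrite -MD; congr M; rewrite -[RHS]/(_, _) /= addr0 add0r.
have E3' u v : u != v -> a u * d v + c u * b v = 0.
  by move=> uv; rewrite E3 addr0 (negbTE uv).
have two : 2%:R != 0 :> F.
  by rewrite -(dvdn_pcharf pcharF) dvdn_prime2 //; apply: contraTneq p_odd => ->.
have k0 : k != 0 by apply: contraNneq kk => ->; rewrite addr0.
(* As k is non-zero, the right side has zero diagonal, while the left side is 2 [g u * h u]
   there. *)
have diag0 g h l : (fun u v => g u * h v + h u * g v) =2 circ_coef k l ->
    forall u, g u * h u = 0.
  move=> gh u; have := gh u u; rewrite /circ_coef.
  have -> : (u == u + k) = false.
    by rewrite -[X in X == _]addr0 (inj_eq (addrI u)) eq_sym (negbTE k0).
  rewrite addr0 [h u * _]mulrC -mulr2n -mulr_natl => /eqP.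
  by rewrite mulf_eq0 (negbTE two) => /eqP.
have ac0 := diag0 _ _ _ E1; have bd0 := diag0 _ _ _ E2.
have pair_neq0 (u : F * F) : u != 0 -> u.1 != 0 \/ u.2 != 0.
  by case: u => x y u0; apply/orP; rewrite -negb_and -xpair_eqE.
(* Injectivity of M makes its block columns (A, C) and (B, D) non-zero; surjectivity does the same
   for the rows. *)
have Minj u : u != 0 -> (M u).1 != 0 \/ (M u).2 != 0.
  move=> u0; apply: pair_neq0; apply: contraNneq u0 => Mu0; apply/eqP.
  by apply: (bij_inj Mbij); rewrite Mu0; apply: esym M0.
have acn0 : exists i, a i != 0 \/ c i != 0.
  apply: (lin_exists_neq0 (x := 1) (y := 1)); rewrite -aP -cP; apply: Minj.
  by rewrite (_ : 0 = (0, 0)) // xpair_eqE oner_eq0.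
have bdn0 : exists i, b i != 0 \/ d i != 0.
  apply: (lin_exists_neq0 (x := 1) (y := 1)); rewrite -bP -dP; apply: Minj.
  by rewrite (_ : 0 = (0, 0)) // xpair_eqE oner_eq0 andbF.
have [Mi _ MiK] := Mbij.
have sum_neq0 (x y : F) : x + y = 1 -> x != 0 \/ y != 0.
  move=> xy; apply/orP; rewrite -negb_and; apply/negP => /andP[/eqP x0 /eqP y0].
  by move/eqP: xy; rewrite x0 y0 addr0 eq_sym oner_eq0.
have abn0 : exists i, a i != 0 \/ b i != 0.
  have := MiK (1, 0); case: (Mi _) => x y; rewrite Msum => /(congr1 fst) /= H.
  by apply: (lin_exists_neq0 (x := x) (y := y)); rewrite -aP -bP; apply: sum_neq0.
have cdn0 : exists i, c i != 0 \/ d i != 0.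
  have := MiK (0, 1); case: (Mi _) => x y; rewrite Msum => /(congr1 snd) /= H.
  by apply: (lin_exists_neq0 (x := x) (y := y)); rewrite -cP -dP; apply: sum_neq0.
have final i j : monomial a i -> monomial d i -> monomial b j -> monomial c j ->
    [\/ [/\ a i != 0, d i != 0, c j = 0 & b j = 0],
       [/\ c j != 0, b j != 0, a i = 0 & d i = 0] |
       [/\ a i != 0, d i != 0, c j != 0, b j != 0 & i = j + k \/ j = i + k]] ->
    s = k /\ r = t.
  move=> ma md mb mc H.
  (* For a monomial with coefficient x at i, the entry of A o_s A at (i + s, i) is [N x]. *)
  pose N x := frob s x * x.
  have N0 : N 0 = 0 by rewrite /N mulr0.
  have Nn0 x : x != 0 -> N x != 0 by move=> x0; rewrite mulf_neq0 ?frob_eq0.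
  have aNn0 x : x != 0 -> alpha * N (frob t x) != 0.
    by move=> x0; rewrite mulf_neq0 ?Nn0 ?frob_eq0.
  have aN0 : alpha * N (frob t 0) = 0 by rewrite frob_id0 N0 mulr0.
  have tw_shift g v : tw g (v + t) = frob t (g v) by rewrite /tw addrK.
  apply: (circ_coef_rigidity (P := N (a i)) (Q := alpha * N (frob t (c j)))
    (P' := N (b j)) (Q' := alpha * N (frob t (d i))) (l := l1)
    kk sk rt al0) => [v|v|].
  - rewrite -E4 (lin_circ_coef_monomial _ ss ma).
    rewrite (lin_circ_coef_monomial _ ss (monomial_shift (t := t) mc)).
    by rewrite -/(tw c _) tw_shift mulrnAr.
  - rewrite -E5 (lin_circ_coef_monomial _ ss mb).
    rewrite (lin_circ_coef_monomial _ ss (monomial_shift (t := t) md)).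
    by rewrite -/(tw d _) tw_shift mulrnAr.
  case: H => [[ai di -> ->]|[cj bj -> ->]|[ai di cj bj ij]].
  - by constructor 1; split; auto.
  - by constructor 2; split; auto.
  by constructor 3; split; auto.
(* A zero block is a monomial at every index, so both indices passed to [final] may coincide. *)
have zero_monomial g i : (forall v, g v = 0) -> monomial g i by move=> g0 v _.
have [i diag] := exists_diagonal abn0 cdn0 acn0 bdn0 ac0 E3'.
(* If [a i = 0], then [c i] and [b i] are non-zero; exchanging the rows (A, B) and (C, D) preserves
   the equations of the second component. *)
have [ai|ai] := eqVneq (a i) 0.
  have cbi : c i * b i != 0 by move: diag; rewrite ai mul0r add0r.
  have ci : c i != 0 by apply: contraNneq cbi => ->; rewrite mul0r.
  have bi : b i != 0 by apply: contraNneq cbi => ->; rewrite mulr0.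
  have di : d i = 0 by apply/eqP; have /eqP := bd0 i; rewrite mulf_eq0 (negbTE bi).
  have E1' u v : c u * a v + a u * c v = circ_coef k l3 u v by rewrite -E1 addrC.
  have E2' u v : d u * b v + b u * d v = circ_coef k (twist r alpha l3) u v.
    by rewrite -E2 addrC.
  have E3'' u v : u != v -> c u * b v + a u * d v = 0 by rewrite addrC; apply: E3'.
  have [mc mb [[d0 a0]|[j [ij dj aj md ma]]]] :=
    monomial_pair kk al0 E1' E2' E3'' ci di ai bi.
    apply: (final i i); auto.
    by constructor 2; split.
  apply: (final j i) => //; constructor 3; split=> //.
  by case: ij; [right | left].
have ci : c i = 0 by apply/eqP; have /eqP := ac0 i; rewrite mulf_eq0 (negbTE ai).
have di : d i != 0.
  by apply: contraNneq diag => ->; rewrite ci mulr0 mul0r addr0.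
have bi : b i = 0.
  by apply/eqP; have /eqP := bd0 i; rewrite mulf_eq0 (negbTE di) orbF.
have [ma md [[b0 c0]|[j [ij bj cj mb mc]]]] := monomial_pair kk al0 E1 E2 E3' ai bi ci di.
  apply: (final i i); auto.
  by constructor 1; split.
by apply: (final i j) => //; constructor 3.
Qed.

End LinearizedPolynomials.

(** * Arithmetic in Z/m and the conclusion *)

Lemma ord_add_eq0 n (i j : 'I_n.+1) :
  i + j = 0 -> (i <= n.+1./2)%N -> (j <= n.+1./2)%N -> i = j.
Proof.
move=> /(congr1 val) ij; rewrite !geq_half_double => i2 j2.
(* As an integer, i + j is at most m, so it is 0 or m; in the second case both are m/2. *)
have [lt_ij|le_ij] := ltnP (i + j)%N n.+1.
  by move: ij; rewrite /= modn_small // => ij; apply: val_inj => /=; lia.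
by apply: val_inj => /=; lia.
Qed.

(** Since 0 < 2k <= m, only 2k = m could fail, and then m / gcd(m, k) = 2 is even. *)
Lemma ord_double_neq0 n (k : 'I_n.+1) :
  (0 < k)%N -> (k <= n.+1./2)%N -> odd (n.+1 %/ gcdn n.+1 k) -> k + k != 0.
Proof.
move=> k0; rewrite geq_half_double leq_eqVlt => /orP[/eqP k2|k2] oddk.
  have mE : n.+1 = (2 * k)%N by rewrite mul2n k2.
  have gcdk : gcdn n.+1 k = k by apply/gcdn_idPr/dvdnP; exists 2.
  have quo : (n.+1 %/ k)%N = 2 by rewrite (congr1 (divn^~ k) mE) mulnK.
  by move: oddk; rewrite gcdk quo.
by apply/eqP => /(congr1 val); rewrite /= addnn modn_small //; lia.
Qed.

Theorem theorem4 (F : finFieldType) (p m : nat) (alpha : F) (k s r t : nat) :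
  prime p -> odd p -> (0 < m)%N -> #|F| = (p ^ m)%N ->
  (forall b : F, b ^+ 2 != alpha) ->
  (0 < k)%N -> (k <= m./2)%N -> (0 < s)%N -> (s <= m./2)%N ->
  odd (m %/ gcdn m k) -> odd (m %/ gcdn m s) ->
  (r <= m./2)%N -> (t <= m./2)%N ->
  (k, (fun x : F => x ^+ (p ^ r))) <> (s, (fun x : F => x ^+ (p ^ t))) ->
  ~ strongly_isotopic (pmul p k (fun x : F => x ^+ (p ^ r)) alpha)
                      (pmul p s (fun x : F => x ^+ (p ^ t)) alpha).
Proof.
move=> p_prime p_odd; case: m => // n _ cardF nonsq.
have half_lt q : (q <= n.+1./2)%N -> (q < n.+1)%N.
  by rewrite geq_half_double; lia.
move=> k0 km s0 sm oddk odds rm tm neq iso.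
pose K := Ordinal (half_lt k km); pose S := Ordinal (half_lt s sm).
pose R := Ordinal (half_lt r rm); pose T := Ordinal (half_lt t tm).
have KK : K + K != 0 by apply: ord_double_neq0.
have SS : S + S != 0 by apply: ord_double_neq0.
(* S + K = 0 would force S = K, hence K + K = 0. *)
have SK : S + K != 0.
  by apply: contraNneq KK => SK; rewrite -{1}(ord_add_eq0 SK sm km) SK.
have RT : R + T = 0 -> R = T by move=> RT; apply: ord_add_eq0.
have alpha0 : alpha != 0 by have := nonsq 0; rewrite expr0n eq_sym.
have [[sk] [rt]] :=
  strong_isotopy_parameters p_prime cardF p_odd alpha0 KK SS SK RT iso.
by apply: neq; rewrite sk rt.
Qed.
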